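(* Let $\mathcal F=[f_{i_1,\ldots,i_d}]\in\mathbb R^{n^{\times d}}_{ps,+}$. Then $$\rho_{\mathrm{trop}}(\mathcal F)=\max_{\gamma\in\Sigma_{n,d-1}}w(\gamma,\mathcal F).$$
   Context: Let $n\ge1$, $d\ge3$ be integers, $[n]=\{1,\dots,n\}$. $\mathbb R^{n^{\times d}}_{ps,+}$ is the set of tensors $\mathcal F=[f_{i_1,\dots,i_d}]$, $i_1,\dots,i_d\in[n]$, with nonnegative real entries symmetric in the last $d-1$ indices. A nonzero nonnegative vector $u\in\mathbb R^n$ is a tropical eigenvector of $\mathcal F$ with tropical eigenvalue $\lambda$ if $\max_{i_2,\dots,i_d\in[n]}f_{i,i_2,\dots,i_d}u_{i_2}\cdots u_{i_d}=\lambda u_i^{d-1}$ for all $i\in[n]$. Tropical eigenvalues exist and are finite in number; $\rho_{\mathrm{trop}}(\mathcal F)$ is the largest one. For $k\ge1$, let $\vec K_{n,k}$ be the multidigraph on $[n]$ in which every directed edge $(i,j)$, $i,j\in[n]$ (loops included), appears exactly $k$ times. A $k$-cycle $\gamma$ is a sub-multidigraph of $\vec K_{n,k}$ with nonempty vertex set $V(\gamma)\subseteq[n]$ such that $\gamma$ is strongly connected (equivalently, its adjacency matrix $A(\gamma)=[a_{vv'}]_{v,v'\in V(\gamma)}$, where $a_{vv'}$ is the number of edges from $v$ to $v'$ in $\gamma$, is irreducible) and every vertex has out-degree $k$, counted with multiplicity. $\Sigma_{n,k}$ is the set of $k$-cycles. For $\gamma\in\Sigma_{n,d-1}$ and $v\in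 V(\gamma)$, let $(v,j_2(v,\gamma)),\dots,(v,j_d(v,\gamma))$ be the $d-1$ edges of $\gamma$ leaving $v$, listed with multiplicity with $j_2(v,\gamma)\le\dots\le j_d(v,\gamma)$. Let $u(\gamma)=(u(\gamma)_v)_{v\in V(\gamma)}$ be the unique positive probability vector with $A(\gamma)^\top u(\gamma)=(d-1)u(\gamma)$. Set $w(\gamma,\mathcal F)=\prod_{v\in V(\gamma)}\big(f_{v,j_2(v,\gamma),\dots,j_d(v,\gamma)}\big)^{u(\gamma)_v}$. *)

(* Defs.v *)
From HB Require Import structures.
From mathcomp Require Import all_boot all_order all_algebra.
From mathcomp Require Import all_classical all_reals all_analysis.

Set Implicit Arguments.
Unset Strict Implicit.
Unset Printing Implicit Defensive.

Import Order.TTheory GRing.Theory Num.Theory.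

Local Open Scope ring_scope.

(* A tensor of order d: the entry f_{i_1, ..., i_d} is F i_1 [tuple i_2; ...; i_d]. *)
Definition tensor (R : realType) (n d : nat) : Type :=
  'I_n -> (d.-1).-tuple 'I_n -> R.

Definition nonneg_partially_symmetric (R : realType) (n d : nat)
    (F : tensor R n d) : Prop :=
  (forall i s, 0 <= F i s) /\
  (forall i (s t : (d.-1).-tuple 'I_n), perm_eq s t -> F i s = F i t).

(* The default value 0 of the iterated maximum is harmless: all the terms are
   nonnegative and there is at least one of them. *)
Definition tropical_eigenpair (R : realType) (n d : nat) (F : tensor R n d)
    (lambda : R) (u : 'cV[R]_n) : Prop :=
  [/\ u != 0, forall i, 0 <= u i 0 &
    forall i, \big[Num.max/0]_(s : (d.-1).-tuple 'I_n)
                (F i s * \prod_(k < d.-1) u (tnth s k) 0)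
              = lambda * u i 0 ^+ d.-1].

Definition tropical_eigenvalues (R : realType) (n d : nat) (F : tensor R n d) :
    set R :=
  [set lambda | exists u, tropical_eigenpair F lambda u]%classic.

(* The largest element of the set of eigenvalues; the default 0 of xget is only
   returned when there is no such element. *)
Definition rho_trop (R : realType) (n d : nat) (F : tensor R n d) : R :=
  xget 0 (tropical_eigenvalues F `&` ubound (tropical_eigenvalues F))%classic.

(* A candidate sub-multidigraph of the multidigraph on [n] in which each edge
   has multiplicity k: a vertex set together with edge multiplicities, which
   are at most k.  Parallel copies of an edge are not distinguished. *)
Definition submultidigraph (n k : nat) : Type :=
  ({set 'I_n} * {ffun 'I_n * 'I_n -> 'I_k.+1})%type.

Definition vertices (n k : nat) (g : submultidigraph n k) : {set 'I_n} := g.1.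

Definition mult (n k : nat) (g : submultidigraph n k) (v w : 'I_n) : nat :=
  g.2 (v, w).

Definition well_formed (n k : nat) (g : submultidigraph n k) : bool :=
  [forall v, forall w, (0 < mult g v w)%N ==>
     (v \in vertices g) && (w \in vertices g)].

Definition strongly_connected (n k : nat) (g : submultidigraph n k) : bool :=
  [forall v in vertices g, forall w in vertices g,
     connect [rel x y | (0 < mult g x y)%N] v w].

Definition out_degree (n k : nat) (g : submultidigraph n k) (v : 'I_n) : nat :=
  (\sum_w mult g v w)%N.

Definition kcycles (n k : nat) : {set submultidigraph n k} :=
  finset (fun g : submultidigraph n k =>
    [&& vertices g != finset.set0, well_formed g, strongly_connected g &
        [forall v in vertices g, out_degree g v == k]]).

(* The nondecreasing list of the heads of the edges leaving v. *)
Definition out_heads (n k : nat) (g : submultidigraph n k) (v : 'I_n) :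
    seq 'I_n :=
  flatten [seq nseq (mult g v w) w | w <- enum 'I_n].

(* When v has out-degree k, the list has length k and the default value v of
   nth is never used. *)
Definition out_tuple (n k : nat) (g : submultidigraph n k) (v : 'I_n) :
    k.-tuple 'I_n :=
  [tuple nth v (out_heads g v) i | i < k].

(* Rows and columns are indexed by the vertices of g, enumerated by enum_val. *)
Definition adjacency (R : realType) (n k : nat) (g : submultidigraph n k) :
    'M[R]_#|vertices g| :=
  \matrix_(a, b) (mult g (enum_val a) (enum_val b))%:R.

Definition is_stationary (R : realType) (n k : nat) (g : submultidigraph n k)
    (u : 'cV[R]_#|vertices g|) : Prop :=
  [/\ forall a, 0 < u a 0, \sum_a u a 0 = 1 &
      (adjacency R g)^T *m u = k%:R *: u].

(* The unique such vector when g is a k-cycle. *)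
Definition stationary (R : realType) (n k : nat) (g : submultidigraph n k) :
    'cV[R]_#|vertices g| :=
  xget 0 [set u | is_stationary u]%classic.

(* Since 0 `^ x = 0 for x != 0 and the exponents are positive, a zero entry of F
   makes the weight vanish. *)
Definition weight (R : realType) (n d : nat) (g : submultidigraph n d.-1)
    (F : tensor R n d) : R :=
  \prod_(a < #|vertices g|)
    (F (enum_val a) (out_tuple g (enum_val a))) `^ (stationary R g a 0).

(* Main.v *)
Require Import Defs.
From HB Require Import structures.
From mathcomp Require Import all_boot all_order all_algebra.
From mathcomp Require Import all_classical all_reals all_analysis.
From mathcomp Require Import ring lra.

Set Implicit Arguments.
Unset Strict Implicit.
Unset Printing Implicit Defensive.

Import Order.TTheory GRing.Theory Num.Theory.
Import numFieldNormedType.Exports.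

Local Open Scope ring_scope.

(* If (lambda, u) is an eigenpair with lambda > 0, choosing a maximizing tuple
   at each vertex of the support of u and restricting to a closed strongly
   connected set of vertices gives a cycle g; multiplying the equations
   F_v,out(v) * prod u_out(v) = lambda * u_v^(d-1) with the stationary
   probabilities as exponents cancels u, so that lambda = w(g, F). The same
   computation with inequalities shows that w(g, F) <= lambda for every cycle g
   as soon as some positive w satisfies T(w) <= lambda * w^(d-1), where T is
   the left-hand side of the eigenvalue equation. Such w, normalized to have
   maximum 1 and with T(w) within O(delta) of lambda * w^(d-1), come from the
   Knaster-Tarski fixed point of a perturbed map; a limit along an ultrafilter
   as delta tends to 0 is an eigenpair whose eigenvalue is at least all the
   weights. *)

(** * Cycles and their stationary vectors *)

Section Cycles.
Variables (R : realType) (n k : nat) (g : submultidigraph n k).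
Hypothesis g_cycle : g \in kcycles n k.

Let edge : rel 'I_n := [rel x y | (0 < mult g x y)%N].

Lemma kcycle_nonempty : (0 < #|vertices g|)%N.
Proof.
by move: g_cycle; rewrite inE => /and4P[+ _ _ _]; rewrite card_gt0.
Qed.

Lemma kcycle_edge (v w : 'I_n) :
  edge v w -> v \in vertices g /\ w \in vertices g.
Proof.
move: g_cycle; rewrite inE => /and4P[_ /forallP wf _ _].
by have /forallP/(_ w)/implyP vw := wf v; move=> /vw /andP.
Qed.

Lemma kcycle_connect (v w : 'I_n) :
  v \in vertices g -> w \in vertices g -> connect edge v w.
Proof.
move: g_cycle; rewrite inE => /and4P[_ _ /'forall_in_'forall_in_idP + _].
by move=> sc vg wg; apply: sc.
Qed.

Lemma kcycle_out_degree (v : 'I_n) :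
  v \in vertices g -> out_degree g v = k.
Proof.
move: g_cycle; rewrite inE => /and4P[_ _ _ /forall_inP deg] vg.
exact/eqP/deg.
Qed.

(** Passes from sums over [n] to sums over matrix indices: an edge leaving [v] can only end in the
    vertex set. *)
Lemma sum_mult_vertices (v : 'I_n) (y : 'I_n -> R) :
  \sum_w (mult g v w)%:R * y w =
  \sum_(b < #|vertices g|) (mult g v (enum_val b))%:R * y (enum_val b).
Proof.
rewrite -(big_enum_val (fun w => (mult g v w)%:R * y w)).
rewrite [RHS]big_mkcond; apply: eq_bigr => w _.
case: ifPn => // wg; case: (posnP (mult g v w)) => [->|vw].
  by rewrite mul0r.
by have [_ ] := kcycle_edge vw; rewrite (negPf wg).
Qed.

Lemma count_out_heads (v w : 'I_n) : count_mem w (out_heads g v) = mult g v w.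
Proof.
rewrite /out_heads count_flatten -map_comp sumnE big_map.
rewrite (bigD1_seq w) ?mem_enum ?enum_uniq //= count_nseq /= eqxx mul1n.
by rewrite big1 ?addn0 // => i /negPf iw; rewrite count_nseq /= iw.
Qed.

Lemma size_out_heads (v : 'I_n) : size (out_heads g v) = out_degree g v.
Proof.
rewrite /out_heads size_flatten /shape -map_comp sumnE big_map big_enum /=.
by apply: eq_bigr => w _; rewrite size_nseq.
Qed.

Lemma out_tupleE (v : 'I_n) :
  v \in vertices g -> out_tuple g v = out_heads g v :> seq 'I_n.
Proof.
move=> vg; apply: (@eq_from_nth _ v) => [|i].
  by rewrite size_tuple size_out_heads kcycle_out_degree.
rewrite size_tuple => ik.
by rewrite (nth_map (Ordinal ik)) ?size_enum_ord // nth_enum_ord.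
Qed.

Lemma sum_out_tuple (v : 'I_n) (y : 'I_n -> R) : v \in vertices g ->
  \sum_(j < k) y (tnth (out_tuple g v) j) = \sum_w (mult g v w)%:R * y w.
Proof.
move=> vg; rewrite -(big_tuple _ _ _ xpredT y) out_tupleE //.
rewrite /out_heads big_flatten big_map big_enum /=; apply: eq_bigr => w _.
by rewrite big_nseq iter_addr_0 mulr_natl.
Qed.

Lemma adjacency_row_sum (a : 'I_#|vertices g|) :
  \sum_b adjacency R g a b = k%:R.
Proof.
transitivity ((out_degree g (enum_val a))%:R : R); last first.
  by rewrite kcycle_out_degree ?enum_valP.
rewrite natr_sum; under [RHS]eq_bigr => w _ do rewrite -[_%:R]mulr1.
rewrite (sum_mult_vertices _ (fun=> 1)).
by apply: eq_bigr => b _; rewrite mxE mulr1.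
Qed.

(* The row sums of the adjacency matrix A are k, so k is an eigenvalue of A^T;
   the entrywise absolute value y of an eigenvector satisfies k y <= A^T y with
   the same total on both sides, hence is an eigenvector, and irreducibility
   spreads positivity along the edges. *)
Lemma stationary_exists :
  exists u : 'cV[R]_#|vertices g|, is_stationary u.
Proof.
have [A defA] : {A | A = adjacency R g} by exists (adjacency R g).
have rowA a : \sum_b A a b = k%:R by rewrite defA adjacency_row_sum.
have A_ge0 a b : 0 <= A a b by rewrite defA mxE ler0n.
have A_edge a b : edge (enum_val a) (enum_val b) -> 0 < A a b.
  by rewrite defA mxE ltr0n.
have /eqP/det0P[x x0 xA] : \det (A - k%:R%:M) = 0.
  rewrite -det_tr; apply/eqP/det0P; exists (const_mx 1).
    apply/eqP => /matrixP/(_ 0 (Ordinal kcycle_nonempty))/eqP.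
    by rewrite !mxE oner_eq0.
  apply/rowP => a; rewrite mxE; under eq_bigr => b _ do rewrite !mxE mul1r.
  rewrite big_split /= rowA sumrN mxE (bigD1 a) //= eqxx mulr1n.
  rewrite big1 ?addr0 ?subrr //.
  by move=> b /negPf ba; rewrite eq_sym ba.
have {}xA b : \sum_a x 0 a * A a b = k%:R * x 0 b.
  move: xA => /eqP; rewrite mulmxBr subr_eq0 mul_mx_scalar => /eqP/rowP/(_ b).
  by rewrite !mxE.
pose y a := `|x 0 a|.
have y_ge0 a : 0 <= y a by exact: normr_ge0.
have le_yA b : k%:R * y b <= \sum_a y a * A a b.
  rewrite /y -(ger0_norm (ler0n R k)) -normrM -xA.
  apply: le_trans (ler_norm_sum _ _ _) _.
  by apply: ler_sum => a _; rewrite normrM (ger0_norm (A_ge0 a b)).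
have yA b : \sum_a y a * A a b = k%:R * y b.
  have /eqP : \sum_b (\sum_a y a * A a b - k%:R * y b) = 0.
    rewrite big_split /= sumrN exchange_big /=.
    under eq_bigr => a _ do rewrite -mulr_sumr rowA mulrC.
    by rewrite subrr.
  rewrite psumr_eq0 => [/allP yA0|c _]; last by rewrite subr_ge0.
  by have := yA0 b (mem_index_enum b); rewrite subr_eq0 => /eqP.
have y_edge a b : edge (enum_val a) (enum_val b) -> 0 < y a -> 0 < y b.
  move=> /A_edge ab ya; rewrite lt_neqAle y_ge0 andbT; apply/eqP => yb.
  have := yA b; rewrite -yb mulr0 (bigD1 a) //= => /eqP.
  have: 0 < y a * A a b by rewrite mulr_gt0.
  have: 0 <= \sum_(i | i != a) y i * A i b.
    by apply: sumr_ge0 => i _; rewrite mulr_ge0.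
  by move=> h1 h2; rewrite gt_eqF // ltr_wpDr.
have [a0 ya0] : exists a, 0 < y a.
  apply: contrapT => y0; move/eqP: x0; apply; apply/rowP => a; rewrite mxE.
  apply/eqP; rewrite -normr_eq0 -/(y a) eq_le y_ge0 andbT leNgt.
  by apply/negP => ya; apply: y0; exists a.
have y_gt0 b : 0 < y b.
  have /connectP[p] := kcycle_connect (enum_valP a0) (enum_valP b).
  elim: p a0 ya0 => [|v p IH] a ya /= => [_ /enum_val_inj -> //|].
  move=> /andP[av vp] bp; have [_ vg] := kcycle_edge av.
  move: av vp bp; rewrite -(enum_rankK_in vg vg) => av vp bp.
  exact: IH (y_edge _ _ av ya) vp bp.
have Y_gt0 : 0 < \sum_a y a.
  by rewrite (bigD1 a0) //= ltr_wpDr // sumr_ge0.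
exists (\col_a (y a / \sum_b y b)); split=> [a||].
- by rewrite mxE divr_gt0.
- by under eq_bigr do rewrite mxE; rewrite -mulr_suml divff ?gt_eqF.
apply/colP => b; rewrite !mxE mulrA -yA mulr_suml -defA.
by apply: eq_bigr => a _; rewrite !mxE mulrA (mulrC (A a b)).
Qed.

Lemma stationaryP : is_stationary (stationary R g).
Proof. exact: (xgetPex _ stationary_exists). Qed.

(** The equation A^T u = k u tested against [y], after exchanging the two sums. It is used with [y]
    the logarithm of a positive vector. *)
Lemma stationary_sum_out_tuple (y : 'I_n -> R) :
  \sum_a stationary R g a 0 * \sum_(j < k) y (tnth (out_tuple g (enum_val a)) j)
  = k%:R * \sum_a stationary R g a 0 * y (enum_val a).
Proof.
have [_ _ uA] := stationaryP.
under eq_bigr => a _.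
  rewrite sum_out_tuple ?enum_valP // sum_mult_vertices mulr_sumr; over.
rewrite exchange_big mulr_sumr /=; apply: eq_bigr => b _.
have /colP/(_ b) := uA; rewrite !mxE mulrA => <-; rewrite mulr_suml.
by apply: eq_bigr => a _; rewrite !mxE mulrA [_%:R * _]mulrC.
Qed.

(** In logarithms, the stationary average of the terms in [w] vanishes by
    [stationary_sum_out_tuple], and ln lambda survives because the exponents sum to 1. Positivity is
    asked on the vertices only, since an eigenvector may vanish elsewhere. *)
Lemma prod_ratio_stationary (lambda : R) (w : 'I_n -> R) :
  0 < lambda -> {in vertices g, forall i, 0 < w i} ->
  \prod_(a < #|vertices g|)
    (lambda * w (enum_val a) ^+ k /
      \prod_(j < k) w (tnth (out_tuple g (enum_val a)) j))
    `^ (stationary R g a 0) = lambda.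
Proof.
move=> lambda_gt0 w_gt0; have [_ u1 _] := stationaryP.
pose y i := ln (w i).
have wE i : i \in vertices g -> w i = expR (y i).
  by move=> ig; rewrite lnK // posrE w_gt0.
have outE (a : 'I_#|vertices g|) :
    \prod_(j < k) w (tnth (out_tuple g (enum_val a)) j) =
    expR (\sum_(j < k) y (tnth (out_tuple g (enum_val a)) j)).
  rewrite expR_sum; apply: eq_bigr => j _; apply: wE.
  have: tnth (out_tuple g (enum_val a)) j \in out_heads g (enum_val a).
    by rewrite -(out_tupleE (enum_valP a)); exact: mem_tnth.
  rewrite -has_pred1 has_count count_out_heads => /kcycle_edge[] //.
under eq_bigr => a _.
  rewrite outE wE ?enum_valP // -expRM_natl -{1}(lnK lambda_gt0) -expRN -!expRD.
  rewrite -expRM mulrC; over.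
rewrite -expR_sum -[RHS](lnK lambda_gt0); congr expR.
under eq_bigr do rewrite mulrBr mulrDr mulrCA.
rewrite sumrB big_split /= -mulr_suml u1 mul1r stationary_sum_out_tuple.
by rewrite mulr_sumr addrK.
Qed.
End Cycles.

(* A set of vertices reachable from one of its points which is minimal for the
   cardinality is strongly connected and closed under the policy. *)
Lemma kcycle_of_policy (n k : nat) (sigma : 'I_n -> k.-tuple 'I_n)
    (S : {set 'I_n}) (i0 : 'I_n) :
  i0 \in S -> (forall i j, i \in S -> j \in sigma i -> j \in S) ->
  exists g : submultidigraph n k,
    [/\ g \in kcycles n k, vertices g \subset S &
      {in vertices g, forall v, perm_eq (out_tuple g v) (sigma v)}].
Proof.
move=> i0S S_closed; pose e := [rel x y | y \in sigma x].
pose reach v := finset (connect e v).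
have [v vS v_min] := @arg_minnP _ i0 (mem S) (fun v => #|reach v|) i0S.
set C := reach v.
have e_C x y : x \in C -> e x y -> y \in C.
  by rewrite !inE => vx xy; exact: connect_trans vx (connect1 xy).
have sub_CS : C \subset S.
  apply/fintype.subsetP => w; rewrite inE => /connectP[p].
  elim: p v vS {v_min C e_C} => [|x p IH] v vS /= => [_ ->//|/andP[vx xp] wE].
  exact: IH (S_closed _ _ vS vx) xp wE.
have C_scc x y : x \in C -> y \in C -> connect e x y.
  (* By minimality the inclusion of [reach x] in [C] is an equality, so [y] is reachable from
     [x]. *)
  move=> xC; have sub_xv : reach x \subset C.
    apply/fintype.subsetP => z; rewrite !inE; apply: connect_trans.
    by rewrite inE in xC.
  have /eqP <- : reach x == C.
    by rewrite eqEcard sub_xv v_min //; exact: (fintype.subsetP sub_CS).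
  by rewrite inE.
pose g : submultidigraph n k := (C, finfun (fun p : 'I_n * 'I_n =>
  if p.1 \in C then inord (count_mem p.2 (sigma p.1)) else ord0)).
(* An entry occurs at most k times in a k-tuple, so [inord] does not truncate. *)
have gE x y : mult g x y = if x \in C then count_mem y (sigma x) else 0%N.
  rewrite /mult ffunE /=; case: ifP => // _; rewrite inordK // ltnS.
  by rewrite -{2}(size_tuple (sigma x)) count_size.
have g_gt0 x y : (0 < mult g x y)%N = (x \in C) && (y \in sigma x).
  by rewrite gE; case: ifP => //= _; rewrite -has_count has_pred1.
have g_cycle : g \in kcycles n k.
  rewrite inE; apply/and4P; split.
  - by apply/set0Pn; exists v; rewrite inE connect0.
  - apply/forallP => x; apply/forallP => y; apply/implyP.
    by rewrite g_gt0 => /andP[xC xy]; rewrite xC (e_C x).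
  - apply/forall_inP => x xC; apply/forall_inP => y yC.
    have /connectP[p xp ->] := C_scc _ _ xC yC.
    elim: p x xC xp => [|z p IH] x xC /= => [_|/andP[xz zp]].
      exact: connect0.
    apply: connect_trans (IH z (e_C _ _ xC xz) zp).
    by apply: connect1; rewrite /= g_gt0 xC.
  - apply/forall_inP => x xC; rewrite /out_degree.
    under eq_bigr do rewrite gE xC.
    rewrite -[X in _ == X](size_tuple (sigma x)) -sum1_size.
    rewrite [X in _ == X](partition_big id xpredT) //=; apply/eqP.
    by apply: eq_bigr => y _; rewrite sum1_count.
exists g; split=> // x xg; rewrite out_tupleE //.
by apply/allP => y _ /=; rewrite count_out_heads gE xg.
Qed.

(** * Cycle weights compared with eigenvalues *)

Section Weights.
Variables (R : realType) (n d : nat) (F : tensor R n d).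
Hypothesis F_ps : nonneg_partially_symmetric F.

(** Each factor of the weight is bounded by the corresponding factor of [prod_ratio_stationary],
    whose product is lambda; zero entries of F are allowed because no logarithm of F is taken. *)
Lemma weight_le (g : submultidigraph n d.-1) (lambda : R) (w : 'I_n -> R) :
  g \in kcycles n d.-1 -> 0 < lambda -> (forall i, 0 < w i) ->
  (forall i s, F i s * \prod_(j < d.-1) w (tnth s j) <= lambda * w i ^+ d.-1) ->
  weight g F <= lambda.
Proof.
move=> g_cycle lambda_gt0 w_gt0 sub_eigen.
have w_gt0' : {in vertices g, forall i, 0 < w i} by move=> i _.
rewrite -[leRHS](prod_ratio_stationary g_cycle lambda_gt0 w_gt0').
have [u_gt0 _ _] := stationaryP R g_cycle.
have W_gt0 a : 0 < \prod_(j < d.-1) w (tnth (out_tuple g (enum_val a)) j).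
  by apply: prodr_gt0.
apply: ler_prod => a _; rewrite powR_ge0 /=.
apply: ge0_ler_powR; rewrite ?nnegrE; first exact: ltW.
- by case: F_ps => + _; apply.
- by rewrite ltW // divr_gt0 ?mulr_gt0 ?exprn_gt0.
- by rewrite ler_pdivlMr.
Qed.

Lemma tropical_eigenvalue_le (lambda : R) :
  tropical_eigenvalues F lambda ->
  lambda <= \big[Num.max/0]_(g in kcycles n d.-1) weight g F.
Proof.
move=> [u [u0 u_ge0 u_eigen]].
have [lambda_le0|lambda_gt0] := leP lambda 0.
  by apply: le_trans lambda_le0 _; exact: bigmax_ge_id.
have [F_ge0 F_sym] := F_ps.
pose S := finset (fun i => 0 < u i 0).
have [i0 i0S] : exists i0, i0 \in S.
  apply: contrapT => S0; move/eqP: u0; apply; apply/colP => i; rewrite mxE.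
  apply/eqP; rewrite eq_le u_ge0 andbT leNgt; apply/negP => ui.
  by apply: S0; exists i; rewrite inE.
have optimal i : exists s, i \in S ->
    F i s * \prod_(k < d.-1) u (tnth s k) 0 = lambda * u i 0 ^+ d.-1.
  (* The constant tuple only shows that some tuple exists; as all terms are nonnegative, the maximum
     is then attained despite its default 0. *)
  have [|s _ sE] := @eq_bigmax _ _ _ 0 [tuple i | _ < d.-1] xpredT
    (fun s => F i s * \prod_(k < d.-1) u (tnth s k) 0) isT.
    by move=> s _; rewrite mulr_ge0 // prodr_ge0.
  by exists s => _; rewrite -u_eigen.
have [sigma sigmaE] := choice optimal.
(* For i in the support the maximal term is positive, so none of its factors u_j can vanish. *)
have sigma_S i j : i \in S -> j \in sigma i -> j \in S.
  move=> iS /tnthP[l ->]; rewrite inE lt_neqAle u_ge0 andbT eq_sym.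
  apply/eqP => ul; move: (sigmaE _ iS); rewrite (bigD1 l) //= ul mul0r mulr0.
  apply/eqP; rewrite lt_eqF // mulr_gt0 // exprn_gt0 //.
  by rewrite inE in iS.
have [g [g_cycle /fintype.subsetP gS gE]] := kcycle_of_policy i0S sigma_S.
apply: (bigmax_sup g) => //.
have u_gt0 : {in vertices g, forall i, 0 < u i 0}.
  by move=> i /gS; rewrite inE.
rewrite -[leLHS](prod_ratio_stationary g_cycle lambda_gt0 u_gt0).
rewrite le_eqVlt; apply/orP; left; apply/eqP; apply: eq_bigr => a _.
have ag := enum_valP a; congr powR.
have prodE : \prod_(j < d.-1) u (tnth (out_tuple g (enum_val a)) j) 0 =
    \prod_(j < d.-1) u (tnth (sigma (enum_val a)) j) 0.
  rewrite -!(big_tuple _ _ _ xpredT (fun i => u i 0)).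
  exact: perm_big (gE _ ag).
(* Partial symmetry identifies the entry at the sorted out-tuple with the entry at the chosen
   maximizer. *)
rewrite prodE -sigmaE ?gS // (F_sym _ _ _ (gE _ ag)) mulfK // gt_eqF //.
apply: prodr_gt0 => j _.
have : tnth (sigma (enum_val a)) j \in S.
  by apply: (sigma_S (enum_val a)); [exact: gS | exact: mem_tnth].
by rewrite inE.
Qed.
End Weights.

(** * Approximate eigenvectors from a monotone fixed point *)

Lemma monotone_box_fixed_point (R : realType) (I : Type) (a b : R)
    (G : (I -> R) -> I -> R) :
  a <= b ->
  (forall x y, (forall i, x i <= y i) -> forall i, G x i <= G y i) ->
  (forall x, (forall i, a <= x i <= b) -> forall i, a <= G x i <= b) ->
  exists x, forall i, G x i = x i.
Proof.
move=> ab G_mono G_box.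
(* Knaster-Tarski: the fixed point is the pointwise supremum of the points of the box lying below
   their image. *)
pose P : set (I -> R) := [set y | (forall i, a <= y i <= b) /\
  (forall i, y i <= G y i)]%classic.
pose x i := sup [set y i | y in P]%classic.
have Pa : P (fun=> a).
  have a_box (i : I) : a <= a <= b by rewrite lexx ab.
  by split=> // i; have /andP[] := G_box _ a_box i.
have x_ub y i : P y -> y i <= x i.
  move=> Py; apply: ub_le_sup; last by exists y.
  by exists b => _ [z [zab _] <-]; have /andP[] := zab i.
have x_le i c : (forall y, P y -> y i <= c) -> x i <= c.
  move=> yc; apply: ge_sup; first by exists a, (fun=> a).
  by move=> _ [z Pz <-]; exact: yc.
have x_box i : a <= x i <= b.
  rewrite (x_ub _ i Pa) /=; apply: x_le => y [yab _].
  by have /andP[] := yab i.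
have x_G i : x i <= G x i.
  apply: x_le => y Py; have [_ /(_ i) yG] := Py.
  by apply: le_trans yG _; apply: G_mono => j; exact: x_ub.
exists x => i; apply/eqP; rewrite eq_le x_G andbT.
by apply: x_ub; split; [exact: G_box | exact: G_mono].
Qed.

Section TropicalMap.
Variables (R : realType) (n d : nat) (F : tensor R n d).
Hypotheses (n_gt0 : (0 < n)%N) (d1_gt0 : (0 < d.-1)%N).
Hypothesis F_ge0 : forall i s, 0 <= F i s.

Definition tropical_map (w : 'I_n -> R) (i : 'I_n) : R :=
  \big[Num.max/0]_(s : (d.-1).-tuple 'I_n)
    (F i s * \prod_(j < d.-1) w (tnth s j)).

(* Raising the exponent d - 1 to d - 1 + delta makes the map a discounted one in
   logarithmic coordinates, so that it preserves a box; adding delta to the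
   entries keeps the logarithms finite. *)
Lemma perturbed_eigenvector (delta : R) : 0 < delta ->
  exists x : 'I_n -> R, forall i,
    expR (((d.-1)%:R + delta) * x i) =
    \big[Num.max/0]_(s : (d.-1).-tuple 'I_n)
      ((F i s + delta) * \prod_(j < d.-1) expR (x (tnth s j))).
Proof.
move=> delta_gt0; set beta := _ + delta.
have beta_gt0 : 0 < beta by rewrite ltr_wpDl.
pose H (x : 'I_n -> R) i := \big[Num.max/0]_(s : (d.-1).-tuple 'I_n)
  ((F i s + delta) * \prod_(j < d.-1) expR (x (tnth s j))).
have Fd_gt0 i s : 0 < F i s + delta by rewrite ltr_wpDl.
have prod_gt0 (x : 'I_n -> R) (s : (d.-1).-tuple 'I_n) :
    0 < \prod_(j < d.-1) expR (x (tnth s j)).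
  by apply: prodr_gt0 => j _; exact: expR_gt0.
have H_gt0 x i : 0 < H x i.
  apply: lt_le_trans (le_bigmax _ _ [tuple i | _ < d.-1]).
  by rewrite mulr_gt0.
have prod_mono (x y : 'I_n -> R) (s : (d.-1).-tuple 'I_n) :
    (forall i, x i <= y i) -> \prod_(j < d.-1) expR (x (tnth s j)) <=
    \prod_(j < d.-1) expR (y (tnth s j)).
  by move=> xy; apply: ler_prod => j _; rewrite expR_ge0 ler_expR xy.
have H_mono x y : (forall i, x i <= y i) -> forall i, H x i <= H y i.
  move=> xy i; apply: bigmax_le => [|s _]; first exact/ltW/H_gt0.
  apply: le_trans (le_bigmax _ _ s); rewrite ler_pM2l //.
  exact: prod_mono.
pose K := \big[Num.max/0]_i \big[Num.max/0]_s (F i s + delta).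
have K_ge i s : F i s + delta <= K.
  exact: le_trans (le_bigmax _ _ s) (le_bigmax _ _ i).
have i0 := Ordinal n_gt0.
have K_ge_delta : delta <= K.
  by apply: le_trans (K_ge i0 [tuple i0 | _ < d.-1]); rewrite lerDr.
have K_gt0 : 0 < K by exact: lt_le_trans K_ge_delta.
have lnK_ge : ln delta <= ln K by rewrite ler_ln ?posrE.
(* The constant functions [a] and [b] are the fixed points of the map when all perturbed entries are
   replaced by their lower bound delta, respectively their upper bound [K]. Monotonicity then keeps
   the box between them stable. *)
pose a := ln delta / delta; pose b := ln K / delta.
have const_prod (c : R) (s : (d.-1).-tuple 'I_n) :
    expR ((d.-1)%:R * c) = \prod_(j < d.-1) expR ((fun=> c) (tnth s j)).
  by rewrite /= prodr_const card_ord expRM_natl.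
have aE : expR (beta * a) = delta * expR ((d.-1)%:R * a).
  by rewrite mulrDl expRD mulrC mulrCA divff ?gt_eqF // mulr1 lnK.
have bE : expR (beta * b) = K * expR ((d.-1)%:R * b).
  by rewrite mulrDl expRD mulrC mulrCA divff ?gt_eqF // mulr1 lnK.
have [|x y xy i|x x_box i|x xE] :=
    @monotone_box_fixed_point R 'I_n a b (fun x i => ln (H x i) / beta).
- by rewrite ler_pM2r ?invr_gt0.
- by rewrite /= ler_pM2r ?invr_gt0 // ler_ln ?posrE //; exact: H_mono.
- rewrite ler_pdivlMr // ler_pdivrMr // ![_ * beta]mulrC.
  apply/andP; split; rewrite -ler_expR lnK ?posrE // ?aE ?bE.
    apply: le_trans (le_bigmax _ _ [tuple i | _ < d.-1]).
    rewrite (const_prod _ [tuple i | _ < d.-1]).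
    apply: ler_pM; rewrite ?(ltW delta_gt0) ?(ltW (prod_gt0 _ _)) ?lerDr //.
      exact: ltW (prod_gt0 (fun=> a) [tuple i | _ < d.-1]).
    by apply: (prod_mono (fun=> a)) => j; have /andP[] := x_box j.
  apply: bigmax_le => [|s _]; first by rewrite mulr_ge0 ?ltW ?expR_gt0.
  rewrite (const_prod _ s).
  apply: ler_pM; rewrite ?(ltW (Fd_gt0 _ _)) ?(ltW (prod_gt0 _ _)) //.
  by apply: (prod_mono _ (fun=> b)) => j; have /andP[] := x_box j.
exists x => i; rewrite -/(H x i) -[RHS]lnK ?posrE //; congr expR.
by rewrite -{1}xE mulrC divfK ?gt_eqF.
Qed.

(** With M the maximum of the perturbed solution x, take w = exp(x - M) and lambda = exp(delta M).
    The perturbed maximum at i equals lambda w_i^(d-1) exp(delta (x_i - M)); the last factor is at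
    most 1, which gives the upper bound on [tropical_map]. *)
Lemma approximate_eigenvector (delta : R) : 0 < delta ->
  exists lambda (w : 'I_n -> R),
    [/\ 0 < lambda, forall i, 0 < w i <= 1, exists i, w i = 1,
      forall i, tropical_map w i <= lambda * w i ^+ d.-1 &
      forall i, lambda * (w i ^+ d.-1 - delta) <= tropical_map w i + delta].
Proof.
move=> delta_gt0; have [x xE] := perturbed_eigenvector delta_gt0.
pose i1 := [arg max_(i > Ordinal n_gt0) x i]%O.
have x_le i : x i <= x i1 by rewrite /i1; case: arg_maxP => // j _; apply.
pose M := x i1; pose w i := expR (x i - M).
have w_gt0 i : 0 < w i by exact: expR_gt0.
have w_le1 i : w i <= 1 by rewrite -[leRHS]expR0 ler_expR subr_le0.
exists (expR (delta * M)), w.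
have prodE (s : (d.-1).-tuple 'I_n) : \prod_(j < d.-1) w (tnth s j) =
    (\prod_(j < d.-1) expR (x (tnth s j))) * expR (- ((d.-1)%:R * M)).
  have -> : expR (- ((d.-1)%:R * M)) = \prod_(j < d.-1) expR (- M).
    by rewrite prodr_const card_ord -expRM_natl mulrN.
  by rewrite -big_split /=; apply: eq_bigr => j _; rewrite -expRD.
have prod_ge0 (s : (d.-1).-tuple 'I_n) : 0 <= \prod_(j < d.-1) w (tnth s j).
  by apply: prodr_ge0 => j _; exact: ltW.
have prod_le1 (s : (d.-1).-tuple 'I_n) : \prod_(j < d.-1) w (tnth s j) <= 1.
  by apply: prodr_ile1 => j _; rewrite w_le1 ltW.
have eigen i : \big[Num.max/0]_(s : (d.-1).-tuple 'I_n)
      ((F i s + delta) * \prod_(j < d.-1) w (tnth s j)) =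
    expR (delta * M) * w i ^+ d.-1 * expR (delta * (x i - M)).
  rewrite -expRM_natl -!expRD.
  have -> : delta * M + (d.-1)%:R * (x i - M) + delta * (x i - M) =
      ((d.-1)%:R + delta) * x i - (d.-1)%:R * M by ring.
  rewrite expRD xE.
  apply: (big_ind2 (fun p q => p = q * expR (- ((d.-1)%:R * M)))).
  - by rewrite mul0r.
  - by move=> _ p _ q -> ->; rewrite maxr_pMl ?expR_ge0.
  - by move=> s _; rewrite prodE mulrA.
split=> [|i||i|i].
- exact: expR_gt0.
- by rewrite w_gt0 w_le1.
- by exists i1; rewrite /w subrr expR0.
- apply: le_trans (_ : expR (delta * M) * w i ^+ d.-1 *
      expR (delta * (x i - M)) <= _); last first.
    apply: ler_piMr; first by rewrite mulr_ge0 ?exprn_ge0 ?expR_ge0 ?ltW.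
    by rewrite -[leRHS]expR0 ler_expR pmulr_rle0 // subr_le0.
  rewrite -eigen; apply: bigmax_le => [|s _].
    exact: bigmax_ge_id.
  apply: le_trans (le_bigmax _ _ s).
  by rewrite ler_wpM2r // lerDl ltW.
apply: le_trans (_ : expR (delta * M) * w i ^+ d.-1 *
    expR (delta * (x i - M)) <= _).
  rewrite -mulrA ler_pM2l ?expR_gt0 //.
  (* This is t exp(-t) <= 1 for t = M - x_i. It makes the loss in exp(-delta t) >= 1 - delta t at
     most delta after multiplication by w_i^(d-1), however large t is. *)
  have wx : w i * (M - x i) <= 1.
    have -> : 1 = w i * expR (M - x i).
      by rewrite -expRD addrA subrK subrr expR0.
    rewrite ler_pM2l //; apply: le_trans (expR_ge1Dx _).
    by rewrite lerDr ler01.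
  have yx : w i ^+ d.-1 * (M - x i) <= 1.
    apply: le_trans wx; apply: ler_wpM2r; first by rewrite subr_ge0.
    by rewrite -[leRHS]expr1; apply: ler_wiXn2l => //; exact: ltW.
  have y_ge0 : 0 <= w i ^+ d.-1 by rewrite exprn_ge0 ?ltW.
  apply: le_trans (ler_wpM2l y_ge0 (expR_ge1Dx _)).
  have -> : w i ^+ d.-1 * (1 + delta * (x i - M)) =
      w i ^+ d.-1 - delta * (w i ^+ d.-1 * (M - x i)) by ring.
  by rewrite lerD2l lerN2 -[leRHS]mulr1 ler_pM2l.
rewrite -eigen; apply: bigmax_le => [|s _].
  by apply: addr_ge0; [exact: bigmax_ge_id | exact: ltW].
rewrite mulrDl lerD //; first exact: (le_bigmax _ _ s).
by rewrite ler_piMr // ltW.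
Qed.
End TropicalMap.

(** * Passage to the limit along an ultrafilter *)

Section Limit.
Local Open Scope classical_set_scope.

(** Compactness of [a, b] gives a cluster point, and an ultrafilter converges to its cluster points:
    it contains the preimage of each neighborhood or that of its complement, and clustering excludes
    the latter. *)
Lemma bounded_ultrafilter_cvg (R : realType) (T : Type) (U : set_system T)
    (u : T -> R) (a b : R) :
  UltraFilter U -> (\forall t \near U, a <= u t <= b) ->
  exists l : R, u t @[t --> U] --> l.
Proof.
move=> U_ultra u_ab; have U_proper := @ultra_proper _ _ U_ultra.
have [|l [_ l_cluster]] := @segment_compact R a b (u t @[t --> U]) _.
  by apply: filterS u_ab => t; rewrite /= in_itv.
exists l => B lB; have [//|UB] := in_ultra_setVsetC (u @^-1` B) U_ultra.
by have [x [/= ]] := l_cluster (~` B) B UB lB.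
Qed.

Lemma bigmax_cvg (R : realType) (T : Type) (U : set_system T) (I : Type)
    (r : seq I) (f : I -> T -> R) (l : I -> R) :
  Filter U -> (forall i, f i t @[t --> U] --> l i) ->
  \big[Num.max/0]_(i <- r) f i t @[t --> U] --> \big[Num.max/0]_(i <- r) l i.
Proof.
move=> U_filter fl; apply: cvg_big => // x; exact: max_continuous.
Qed.

Lemma prod_cvg (R : realType) (T : Type) (U : set_system T) (I : Type)
    (r : seq I) (f : I -> T -> R) (l : I -> R) :
  Filter U -> (forall i, f i t @[t --> U] --> l i) ->
  \prod_(i <- r) f i t @[t --> U] --> \prod_(i <- r) l i.
Proof.
move=> U_filter fl; apply: cvg_big => // x; exact: mul_continuous.
Qed.

Lemma tropical_map_cvg (R : realType) (n d : nat) (F : tensor R n d)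
    (T : Type) (U : set_system T) (w : T -> 'I_n -> R) (l : 'I_n -> R) i :
  Filter U -> (forall i, w t i @[t --> U] --> l i) ->
  tropical_map F (w t) i @[t --> U] --> tropical_map F l i.
Proof.
move=> U_filter wl; apply: bigmax_cvg => s; apply: cvgM; first exact: cvg_cst.
by apply: prod_cvg.
Qed.

Lemma tropical_eigenvalue_ge (R : realType) (n d : nat) (F : tensor R n d) :
  (0 < n)%N -> (0 < d.-1)%N -> nonneg_partially_symmetric F ->
  exists2 lambda, tropical_eigenvalues F lambda &
    \big[Num.max/0]_(g in kcycles n d.-1) weight g F <= lambda.
Proof.
move=> n_gt0 d1_gt0 F_ps; have [F_ge0 _] := F_ps.
(* The shift by 2 gives delta <= 1/2, so that lambda (1 - delta) <= K + delta, read at a coordinate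
   where w is 1, bounds lambda. *)
pose delta (m : nat) : R := m.+2%:R^-1.
have delta_gt0 m : 0 < delta m by rewrite invr_gt0.
have delta_le m : delta m <= 2^-1 by rewrite lef_pV2 ?posrE // ler_nat.
have [lambda approx] := choice
  (fun m => approximate_eigenvector n_gt0 d1_gt0 F_ge0 (delta_gt0 m)).
have {approx}[w approx] := choice approx.
pose W := \big[Num.max/0]_(g in kcycles n d.-1) weight g F.
have W_le m : W <= lambda m.
  have [lambda_gt0 w01 _ super _] := approx m.
  apply: bigmax_le => [|g g_cycle]; first exact: ltW.
  apply: (weight_le F_ps g_cycle lambda_gt0 (w := w m)) => [i|i s].
    by have /andP[] := w01 i.
  exact: le_trans (le_bigmax _ _ s) (super i).
pose K := \big[Num.max/0]_i \big[Num.max/0]_s F i s.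
have lambda_le m : lambda m <= 2 * (K + 1).
  have [lambda_gt0 w01 [i wi1] _ /(_ i)] := approx m.
  have TK : tropical_map F (w m) i <= K.
    apply: bigmax_le => [|s _]; first exact: bigmax_ge_id.
    apply: le_trans (_ : F i s <= _); last first.
      exact: le_trans (le_bigmax _ _ s) (le_bigmax _ _ i).
    apply: ler_piMr => //; apply: prodr_ile1 => j _.
    by have /andP[/ltW -> ->] := w01 (tnth s j).
  rewrite wi1 expr1n; have := delta_le m; have := delta_gt0 m.
  nra.
(* A single ultrafilter makes lambda and all coordinates of w converge at once, without successive
   subsequences. *)
have [U [U_ultra U_oo]] := ultraFilterLemma (F := \oo) _.
have U_proper := @ultra_proper _ _ U_ultra.
have delta_cvg : delta m @[m --> U] --> 0.
  apply: cvg_trans (_ : delta m @[m --> \oo] --> 0); first exact: cvg_app.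
  have : @harmonic R m @[m --> \oo] --> 0 by exact: cvg_harmonic.
  by rewrite -cvg_shiftS.
have [l lambda_cvg] : exists l : R, lambda m @[m --> U] --> l.
  apply: (@bounded_ultrafilter_cvg _ _ _ _ W (2 * (K + 1))) => //.
  by apply: nearW => m; rewrite W_le lambda_le.
have w_cvg_ex i : exists v : R, w m i @[m --> U] --> v.
  apply: (@bounded_ultrafilter_cvg _ _ _ _ 0 1) => //.
  by apply: nearW => m; have [_ /(_ i)/andP[/ltW -> ->]] := approx m.
have [v w_cvg] := choice w_cvg_ex.
have T_cvg i : tropical_map F (w m) i @[m --> U] --> tropical_map F v i.
  exact: tropical_map_cvg.
have wX_cvg i : w m i ^+ d.-1 @[m --> U] --> v i ^+ d.-1.
  apply: (@continuous_cvg _ R R U _ _ (fun y => y ^+ d.-1)); last exact: w_cvg.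
  exact: exprn_continuous.
exists l; last first.
  by apply: (cvgr_to_ge lambda_cvg); exact: nearW.
exists (\col_i v i); split=> [|i|i].
- apply/eqP => v0.
  (* The coordinate where [w m] equals 1 depends on m; the sum of the coordinates gives a lower
     bound that survives in the limit. *)
  have: 1 <= \sum_i v i.
    apply: (@cvgr_to_ge _ U _ _ (fun m => \sum_i w m i)).
      by apply: cvg_big => // x; exact: add_continuous.
    apply: nearW => m; have [_ w01 [i wi1] _ _] := approx m.
    rewrite (bigD1 i) //= wi1 lerDl sumr_ge0 // => j _.
    by have /andP[/ltW] := w01 j.
  rewrite big1 ?ler10 // => i _.
  by have /colP/(_ i) := v0; rewrite !mxE.
- rewrite mxE; apply: (cvgr_to_ge (w_cvg i)); apply: nearW => m.
  by have [_ /(_ i)/andP[/ltW]] := approx m.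
rewrite mxE; transitivity (tropical_map F v i).
  by apply: eq_bigr => s _; congr (_ * _); apply: eq_bigr => j _; rewrite mxE.
apply/eqP; rewrite eq_le; apply/andP; split.
  apply: (ler_cvg_to (T_cvg i) (cvgM lambda_cvg (wX_cvg i))).
  by apply: nearW => m; have [] := approx m.
(* The inserted zeros are the limits of the two delta errors in the approximate lower bound. *)
rewrite -[tropical_map F v i]addr0 -[v i ^+ d.-1]subr0.
apply: (ler_cvg_to (cvgM lambda_cvg (cvgB (wX_cvg i) delta_cvg))
  (cvgD (T_cvg i) delta_cvg)).
by apply: nearW => m; have [_ _ _ _] := approx m; apply.
Qed.
End Limit.

Theorem theorem26 (R : realType) (n d : nat) (n_gt0 : (0 < n)%N)
    (d_gt2 : (2 < d)%N) (F : tensor R n d)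
    (F_ps : nonneg_partially_symmetric F) :
  rho_trop F = \big[Num.max/0]_(g in kcycles n d.-1) weight g F.
Proof.
have d1_gt0 : (0 < d.-1)%N by case: d d_gt2 {F F_ps} => [|[]].
have [lambda eigen W_le] := tropical_eigenvalue_ge n_gt0 d1_gt0 F_ps.
have lambdaE : lambda = \big[Num.max/0]_(g in kcycles n d.-1) weight g F.
  by apply/eqP; rewrite eq_le W_le (tropical_eigenvalue_le F_ps eigen).
(* [lambda] is the only eigenvalue bounding all eigenvalues, so [xget] returns it and not its
   default. *)
rewrite -lambdaE; apply: xget_unique => [|mu [mu_eigen mu_ub]].
  by split=> // mu /(tropical_eigenvalue_le F_ps); rewrite lambdaE.
apply/eqP; rewrite eq_le mu_ub // andbT lambdaE.
exact: tropical_eigenvalue_le.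
Qed.
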